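(* The equality $$\inf\big\{\|T+I\| : T\in\mathcal L(X),\ \|T\|=1,\ T\text{ is weakly compact}\big\}=\max\{\mathcal T(X),\mathcal T_{w^*}(X^* )\}$$ does not hold for every Banach space $X$; that is, there exists a Banach space $X$ for which it fails.
   Context: All Banach spaces are nontrivial and real. $B_X$ and $S_X$ denote the closed unit ball and the unit sphere of $X$, $X^*$ is the dual, $B(x,r)$ is the ball with center $x$ and radius $r$, $\mathcal L(X)$ is the space of bounded linear operators on $X$, and $I$ is the identity operator on $X$. - $\mathcal T(X)=\inf\{r>0:$ there exist $x\in S_X$ and a relatively weakly open subset $W$ of $B_X$ such that $\emptyset\ne W\subset B(x,r)\}$; - $\mathcal T_{w^*}(X^* )=\inf\{r>0:$ there exist $x^*\in S_{X^*}$ and a relatively weak$^*$ open subset $W$ of $B_{X^*}$ such that $\emptyset\ne W\subset B(x^*,r)\}$. *)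

(* Defs.v *)
From mathcomp Require Import all_boot all_order all_algebra.
From mathcomp Require Import all_classical all_reals all_analysis.
Import Order.TTheory GRing.Theory Num.Theory.
Import numFieldNormedType.Exports.

Set Implicit Arguments.
Unset Strict Implicit.
Unset Printing Implicit Defensive.

Local Open Scope classical_set_scope.
Local Open Scope ring_scope.

Definition unit_ball (R : realType) (X : normedModType R) : set X :=
  [set x | `|x| <= 1].
Arguments unit_ball {R} X.

(* A real supremum: it is the operator norm only when f is linear and bounded
   (for an unbounded f, [sup] returns the default value 0). *)
Definition opnorm (R : realType) (X Y : normedModType R) (f : X -> Y) : R :=
  sup [set `|f x| | x in unit_ball X].

Definition bounded_op (R : realType) (X Y : normedModType R) :
    set {linear X -> Y} :=
  [set T | bounded_fun_norm T].
Arguments bounded_op {R} X Y.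

Definition dual (R : realType) (X : normedModType R) : set {linear X -> R^o} :=
  bounded_op X R^o.
Arguments dual {R} X.

Definition dual_fun (R : realType) (X : normedModType R) (f : dual X) :
    X -> R^o :=
  (set_val f : {linear X -> R^o}).

(* The product topology on R^(X^* ) pulled back along evaluation, i.e. the
   coarsest topology on X for which every element of X^* is continuous. *)
Definition weak (R : realType) (X : normedModType R) : Type :=
  initial_topology
    (fun x : X => (fun f : dual X => dual_fun f x) : {ptws dual X -> R^o}).

Definition weak_star (R : realType) (X : normedModType R) : Type :=
  initial_topology (fun f : dual X => dual_fun f : {ptws X -> R^o}).

Definition weakly_compact (R : realType) (X Y : normedModType R)
    (T : X -> Y) : Prop :=
  precompact (T @` unit_ball X : set (weak Y)).

(* [ball x r] is the open norm ball; since r is minimised, closed balls give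
   the same infimum. *)
Definition weak_index (R : realType) (X : normedModType R) : R :=
  inf [set r : R | 0 < r /\
    exists (x : X) (U : set (weak X)),
      [/\ `|x| = 1, open U, unit_ball X `&` U !=set0
        & unit_ball X `&` U `<=` ball x r]].

Definition dual_unit_ball (R : realType) (X : normedModType R) :
    set (dual X) :=
  [set f | opnorm (dual_fun f) <= 1].
Arguments dual_unit_ball {R} X.

Definition dual_ball (R : realType) (X : normedModType R) (f : dual X) (r : R) :
    set (dual X) :=
  [set g | opnorm (dual_fun f \- dual_fun g) < r].

Definition weak_star_index (R : realType) (X : normedModType R) : R :=
  inf [set r : R | 0 < r /\
    exists (f : dual X) (U : set (weak_star X)),
      [/\ opnorm (dual_fun f) = 1, open U, dual_unit_ball X `&` U !=set0
        & dual_unit_ball X `&` U `<=` dual_ball f r]].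

(* Main.v *)
(* The space is c_0 with the norm |x_0| + sup_n |x_n|.  If T is weakly compact,
   then ||T + I|| >= 1 because c_0 is not reflexive.  Both indices are at most
   3/4: a point x of the unit ball with x_0 close to its maximal value 1/2 has
   |x_n| <= 1 - x_0 for all n, so it is at distance about 1/2 from e_0/2.
   Dually, e_0/2 + z/2 lies in the unit ball whenever z_0 = 0 and
   sup |z_n| <= 1, so a functional g of norm at most 1 with g(e_0) close to its
   maximal value 2 is small at all such z, hence close to 2 e_0^*. *)
Require Import Defs.
From HB Require Import structures.
From mathcomp Require Import all_boot all_order all_algebra.
From mathcomp Require Import all_classical all_reals all_analysis.
From mathcomp Require Import ring lra.
Import Order.TTheory GRing.Theory Num.Theory.
Import numFieldNormedType.Exports.
Local Open Scope classical_set_scope.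
Local Open Scope ring_scope.

Set Implicit Arguments.
Unset Strict Implicit.
Unset Printing Implicit Defensive.

(** * Bounds on the operator norm *)

Section operator_norm.
Context {R : realType} {X Y : normedModType R}.
Implicit Type f : X -> Y.

Lemma unit_ball0 : unit_ball X 0.
Proof. by rewrite /unit_ball /= normr0 ler01. Qed.

Lemma le_opnorm f x : bounded_fun_norm f -> `|x| <= 1 -> `|f x| <= opnorm f.
Proof.
move=> /(_ 1)[M fM] x1; apply: ub_le_sup; last by exists x.
by exists M => _ [y /fM ? <-].
Qed.

Lemma opnorm_le f M : (forall x, `|x| <= 1 -> `|f x| <= M) -> opnorm f <= M.
Proof.
move=> fM; apply: ge_sup; first by exists `|f 0|, 0 => //; exact: unit_ball0.
by move=> _ [x /fM ? <-].
Qed.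

Lemma linear_bounded_fun_norm (f : {linear X -> Y}) M :
  (forall x, `|f x| <= M * `|x|) -> bounded_fun_norm f.
Proof.
move=> fM r; exists (`|M| * r) => x xr; apply: le_trans (fM x) _.
by apply: (le_trans (ler_wpM2r (normr_ge0 x) (ler_norm M))); rewrite ler_wpM2l.
Qed.

End operator_norm.

(** * Weak and weak* topologies, and upper bounds for the two indices *)

Section weak_topology.
Context {R : realType} {X : normedModType R}.

Lemma weak_continuous (f : dual X) :
  continuous (dual_fun f : weak X -> R^o).
Proof.
move=> x.
apply: (@continuous_comp (weak X) {ptws dual X -> R^o} R^o
  (fun y g => dual_fun g y) (fun h => h f)).
  exact: initial_continuous.
exact: proj_continuous.
Qed.

Lemma weak_star_continuous (x : X) :
  continuous ((fun f => dual_fun f x) : weak_star X -> R^o).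
Proof.
move=> f.
apply: (@continuous_comp (weak_star X) {ptws X -> R^o} R^o
  (fun g => dual_fun g) (fun h => h x)).
  exact: initial_continuous.
exact: proj_continuous.
Qed.

Lemma weak_index_le r (x : X) (U : set (weak X)) : 0 < r -> `|x| = 1 ->
  open U -> unit_ball X `&` U !=set0 -> unit_ball X `&` U `<=` ball x r ->
  weak_index X <= r.
Proof.
move=> r0 x1 oU U0 Ur; apply: ge_inf; first by exists 0 => s [/ltW].
by split=> //; exists x, U.
Qed.

Lemma weak_star_index_le r (f : dual X) (U : set (weak_star X)) : 0 < r ->
  opnorm (dual_fun f) = 1 -> open U -> dual_unit_ball X `&` U !=set0 ->
  dual_unit_ball X `&` U `<=` dual_ball f r -> weak_star_index X <= r.
Proof.
move=> r0 x1 oU U0 Ur; apply: ge_inf; first by exists 0 => s [/ltW].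
by split=> //; exists f, U.
Qed.

Lemma dual_fun_linear (f : dual X) : linear (dual_fun f).
Proof. by move=> a x y; rewrite /dual_fun linearP. Qed.

Lemma dual_fun_bounded (f : dual X) : bounded_fun_norm (dual_fun f).
Proof. by case: f => f fb; exact: (set_mem fb). Qed.

Lemma dual_unit_ball_le (f : dual X) x :
  dual_unit_ball X f -> `|x| <= 1 -> `|dual_fun f x| <= 1.
Proof.
by move=> f1 x1; apply: le_trans f1; exact: le_opnorm (dual_fun_bounded f) x1.
Qed.

Definition dual_of (f : {linear X -> R^o}) (bf : bounded_fun_norm f) : dual X :=
  exist (fun g => g \in dual X) f (mem_set bf).

(** Makes segments through 0 weakly compact. The product topology is a supremum over the functionals
    [f], so it suffices to test one [f] at a time, where the map becomes multiplication by
    [dual_fun f x]. *)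
Lemma scale_weak_continuous (x : X) : continuous (fun r : R => r *: x : weak X).
Proof.
apply: (@continuous_comp_initial X R {ptws dual X -> R^o}) => r.
apply/cvg_sup => f.
apply: (@continuous_comp_initial (dual X -> R^o) R R^o (fun h => h f)) => {}r.
have -> : (fun h : dual X -> R^o => h f) \o
    ((fun x0 : X => (@dual_fun R X)^~ x0) \o (fun s : R => s *: x)) =
    (fun s : R => s * dual_fun f x : R^o).
  by apply/funext => s; rewrite /= /dual_fun linearZ.
by apply: cvgMl; exact: cvg_id.
Qed.

End weak_topology.

(** * The renormed space c_0 and its completeness *)

Section c0.
Context {R : realType}.

Definition c0 : {pred nat -> R} := fun x => `[< x @ \oo --> 0 >].

Lemma c0_submod_closed : submod_closed c0.
Proof.
split=> [|a x y /asboolP cx /asboolP cy]; apply/asboolP; first exact: cvg_cst.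
rewrite -[X in _ --> X](addr0 (0 : R)) -{1}(mulr0 a).
by apply: cvgD cy; apply: cvgM cx; exact: cvg_cst.
Qed.

HB.instance Definition _ := GRing.isSubmodClosed.Build _ _ c0 c0_submod_closed.

Record c0_space := C0 { c0_val :> nat -> R; _ : c0_val \in c0 }.

HB.instance Definition _ := [isSub for c0_val].
HB.instance Definition _ := [Choice of c0_space by <:].
HB.instance Definition _ := [SubChoice_isSubLmodule of c0_space by <:].

Implicit Types x y : c0_space.

Lemma c0_cvg x : x n @[n --> \oo] --> 0.
Proof. by case: x => x /= /asboolP. Qed.

Lemma c0P x y : (forall n, x n = y n) -> x = y.
Proof. by move=> xy; apply/val_inj/funext. Qed.

Lemma c0D x y n : (x + y) n = x n + y n. Proof. by []. Qed.
Lemma c0B x y n : (x - y) n = x n - y n. Proof. by []. Qed.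
Lemma c0Z a x n : (a *: x) n = a * x n. Proof. by []. Qed.

Definition c0_norm x := `|x 0%N| + sup (range (fun n => `|x n|)).

Lemma c0_has_sup x : has_sup (range (fun n => `|x n|)).
Proof.
split; first by exists `|x 0%N|, 0%N.
have [M [_ xM]] := cvg_seq_bounded (cvgP _ (c0_cvg x)).
by exists (M + 1) => _ [n _ <-]; apply: xM => //; rewrite ltrDl.
Qed.

Lemma coord_le_c0_norm x n : `|x 0%N| + `|x n| <= c0_norm x.
Proof.
by rewrite lerD2l; apply: sup_upper_bound (c0_has_sup x) _ _; exists n.
Qed.

Lemma c0_norm_le x M : (forall n, `|x n| <= M) -> c0_norm x <= `|x 0%N| + M.
Proof.
move=> xM; rewrite lerD2l; apply: ge_sup; first exact: (c0_has_sup x).1.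
by move=> _ [n _ <-].
Qed.

Lemma c0_normD x y : c0_norm (x + y) <= c0_norm x + c0_norm y.
Proof.
(* [M] is the sum of the two sup norms, the head terms being subtracted. *)
pose M := c0_norm x - `|x 0%N| + (c0_norm y - `|y 0%N|).
apply: le_trans (c0_norm_le (M := M) _) _.
  move=> n; rewrite c0D (le_trans (ler_normD _ _))//.
  by rewrite lerD// lerBrDl coord_le_c0_norm.
by have := ler_normD (x 0%N) (y 0%N); rewrite c0D /M; lra.
Qed.

Lemma c0_normZ a x : c0_norm (a *: x) = `|a| * c0_norm x.
Proof.
have le b y : c0_norm (b *: y) <= `|b| * c0_norm y.
  apply: le_trans (c0_norm_le (M := `|b| * (c0_norm y - `|y 0%N|)) _) _.
    by move=> n; rewrite c0Z normrM ler_wpM2l// lerBrDl coord_le_c0_norm.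
  by rewrite c0Z normrM -mulrDr addrC subrK.
have [->|a0] := eqVneq a 0.
  apply/eqP; rewrite eq_le le /= normr0 mul0r.
  by apply: le_trans (coord_le_c0_norm _ 0%N); rewrite addr_ge0.
apply/eqP; rewrite eq_le le /=.
(* The reverse inequality is the first one applied to the inverse scalar. *)
have := le a^-1 (a *: x); rewrite scalerA mulVf// scale1r normfV.
by rewrite ler_pdivlMl// normr_gt0.
Qed.

Lemma c0_norm_eq0 x : c0_norm x = 0 -> x = 0.
Proof.
move=> x0; apply: c0P => n; apply/eqP; rewrite -normr_le0 -x0.
by apply: le_trans (coord_le_c0_norm x n); rewrite lerDr.
Qed.

HB.instance Definition _ :=
  Lmodule_isNormed.Build R c0_space c0_normD c0_normZ c0_norm_eq0.

Lemma c0_coord_pair_le x n : `|x 0%N| + `|x n| <= `|x|.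
Proof. exact: coord_le_c0_norm. Qed.

Lemma c0_coord_le x n : `|x n| <= `|x|.
Proof. by apply: le_trans (c0_coord_pair_le x n); rewrite lerDr. Qed.

Lemma c0_le_norm x M : (forall n, `|x n| <= M) -> `|x| <= `|x 0%N| + M.
Proof. exact: c0_norm_le. Qed.

(** The limit is built coordinatewise. A Cauchy estimate in norm bounds all coordinates at once, so
    it passes to the limit uniformly in [n]; this puts [y] in c_0 and gives norm convergence. *)
Lemma c0_complete (F : set_system c0_space) :
  ProperFilter F -> cauchy F -> cvg F.
Proof.
move=> FF /cauchyP cF.
have cF' n : cvg ((fun x : c0_space => x n) @ F).
  apply/cauchy_cvgP/cauchy_exP => e e0; have [x Fx] := cF e e0.
  exists (x n); suff : F [set u : c0_space | ball (x n) e (u n)] by [].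
  apply: filterS Fx => u; rewrite -ball_normE /ball /= => xu.
  by apply: le_lt_trans xu; exact: (c0_coord_le (x - u)).
pose y n := lim ((fun x : c0_space => x n) @ F).
have near_y e x : 0 < e -> F (ball x e) -> forall n, `|x n - y n| <= e.
  move=> e0 Fx n; have cy : (fun u : c0_space => x n - u n) @ F --> x n - y n.
    by apply: cvgB; [exact: cvg_cst|exact: cF'].
  apply: (cvgr_to_le (cvg_norm cy)).
  apply: filterS Fx => u; rewrite -ball_normE /= => /ltW; apply: le_trans.
  exact: (c0_coord_le (x - u)).
have yc0 : y \in c0.
  apply/asboolP/cvgrPdist_lt => e e0.
  have [x Fx] := cF (e / 2) (divr_gt0 e0 (ltr0n _ 2)).
  have := near_y _ _ (divr_gt0 e0 (ltr0n _ 2)) Fx => xy.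
  have /cvgrPdist_lt/(_ (e / 2) (divr_gt0 e0 (ltr0n _ 2))) := c0_cvg x.
  apply: filterS => n; rewrite !sub0r !normrN => xn.
  have := ler_normB (x n) (x n - y n); rewrite subKr.
  by have := xy n; lra.
apply/cvg_ex; exists (C0 yc0); apply/cvgrPdist_le => e e0.
(* Two errors of [e / 4] give [e / 2] per coordinate, and the norm adds the head coordinate to the
   supremum, which makes [e]. *)
have e4 : 0 < e / 4 by rewrite divr_gt0.
have [x Fx] := cF _ e4; have xy := near_y _ _ e4 Fx.
apply: filterS Fx => u; rewrite -ball_normE /= => xu.
have uy n : `|(C0 yc0 - u) n| <= e / 2.
  have -> : (C0 yc0 - u) n = x n - u n - (x n - y n) by rewrite c0B /=; ring.
  have := c0_coord_le (x - u) n; rewrite c0B.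
  by have := xy n; have := ler_normB (x n - u n) (x n - y n); lra.
by apply: le_trans (c0_le_norm uy) _; have := uy 0%N; lra.
Qed.

HB.instance Definition _ := Uniform_isComplete.Build c0_space c0_complete.


Lemma eventually0_c0 (f : nat -> R) N :
  (forall n, (N <= n)%N -> f n = 0) -> f \in c0.
Proof.
by move=> f0; apply/asboolP/(cvg_near_cst 0); exists N => // n /= /f0.
Qed.

Lemma c0_coord_linear n :
  linear ((fun x => x n) : c0_space -> R^o).
Proof. by []. Qed.

Definition c0_coord n x : R^o := x n.

HB.instance Definition _ n :=
  GRing.isLinear.Build R c0_space R^o _ (c0_coord n) (c0_coord_linear n).

Lemma c0_coord_bounded n : bounded_fun_norm (c0_coord n).
Proof.
apply: (@linear_bounded_fun_norm _ _ _ _ 1) => x.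
by rewrite mul1r; exact: c0_coord_le.
Qed.

Definition c0_dual n : dual c0_space := dual_of (@c0_coord_bounded n).

Lemma c0_dualE n x : dual_fun (c0_dual n) x = x n. Proof. by []. Qed.

Lemma c0_e0_subproof : (fun n => (n == 0%N)%:R : R) \in c0.
Proof. by apply: (@eventually0_c0 _ 1) => -[]. Qed.

Definition c0_e0 := C0 c0_e0_subproof.

Lemma c0_e0E n : c0_e0 n = (n == 0%N)%:R. Proof. by []. Qed.

Lemma c0_step_subproof m : (fun n => (0 < n <= m)%N%:R : R) \in c0.
Proof.
by apply: (@eventually0_c0 _ m.+1) => n mn; rewrite [(n <= m)%N]leqNgt mn andbF.
Qed.

(** These sums e_1 + ... + e_m increase to a bounded sequence outside c_0. Coordinate 0 is left out
    to keep them in the unit ball. *)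
Definition c0_step m := C0 (c0_step_subproof m).

Lemma c0_stepE m n : c0_step m n = (0 < n <= m)%N%:R. Proof. by []. Qed.

Lemma c0_stepm0 m : c0_step m 0%N = 0. Proof. by []. Qed.

End c0.
Arguments c0_space : clear implicits.

(** * The two indices and the weakly compact operators of the renormed c_0 *)

Section c0_indices.
Context {R : realType}.
Local Notation X := (c0_space R).
Local Notation e0 := (@c0_e0 R).
Implicit Types (x : X) (T : {linear X -> X}).

Lemma norm_c0_e0 : `|e0| = 2.
Proof.
have e0_0 : `|e0 0%N| = 1 :> R by rewrite c0_e0E normr1.
apply/eqP; rewrite eq_le; apply/andP; split; last first.
  by have := c0_coord_pair_le e0 0; rewrite e0_0; lra.
rewrite (_ : 2 = `|e0 0%N| + 1); last by rewrite e0_0; lra.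
by apply: c0_le_norm => n; rewrite c0_e0E; case: eqP; rewrite (normr1, normr0).
Qed.

Lemma c0_head_le x : 2 * `|x 0%N| <= `|x|.
Proof. by have := c0_coord_pair_le x 0; lra. Qed.

Lemma c0_step_le1 m : `|c0_step m : X| <= 1.
Proof.
rewrite -[leRHS]add0r -[X in X + _](@normr0 _ R) -(c0_stepm0 m).
apply: c0_le_norm => n; rewrite c0_stepE ger0_norm ?ler0n// lern1.
by case: (_ && _).
Qed.

Lemma c0_weak_index_le : weak_index X <= 3 / 4.
Proof.
(* In the unit ball this forces the head into (7/16, 1/2] and the other coordinates below 9/16, so
   the distance to e_0/2 is at most 1/16 + 9/16 = 5/8. *)
pose U : set (weak X) := dual_fun (c0_dual 0) @^-1` [set r : R | 7 / 16 < r].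
have e1 : `|2^-1 *: e0| = 1 by rewrite normrZ norm_c0_e0 ger0_norm// mulVf.
apply: (@weak_index_le _ _ _ (2^-1 *: e0) U) => //.
- apply: open_comp; last exact: open_gt.
  by move=> x _; exact: weak_continuous.
- exists (2^-1 *: e0); split; first by rewrite /unit_ball /= e1.
  by rewrite /U /= c0_dualE c0Z c0_e0E /=; lra.
- move=> x [x1 xU].
  have {}x1 : `|x| <= 1 by [].
  have {}xU : 7 / 16 < x 0%N by [].
  have x0 : `|x 0%N| = x 0%N by rewrite ger0_norm//; lra.
  have y0 : `|(2^-1 *: e0 - x) 0%N| <= 1 / 16.
    rewrite c0B c0Z c0_e0E /= mulr1 ler_norml.
    by have := c0_head_le x; rewrite x0; lra.
  rewrite -ball_normE /=; apply: (@le_lt_trans _ _ (1 / 16 + 9 / 16)); last lra.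
  apply: le_trans (c0_le_norm (M := 9 / 16) _) _; last by rewrite lerD2r.
  move=> [|n]; first by apply: le_trans y0 _; lra.
  rewrite c0B c0Z c0_e0E /= mulr0 sub0r normrN.
  by have := c0_coord_pair_le x n.+1; rewrite x0; lra.
Qed.

Lemma c0_head2_bounded :
  bounded_fun_norm (2 \*: (c0_coord 0 : X -> R^o)).
Proof.
apply: (@linear_bounded_fun_norm _ _ _ _ 1) => x.
by rewrite mul1r /= normrM ger0_norm//; exact: c0_head_le.
Qed.

Definition c0_head2 : dual X := dual_of c0_head2_bounded.

Lemma c0_head2E x : dual_fun c0_head2 x = 2 * x 0%N.
Proof. by []. Qed.

Lemma c0_head2_opnorm : opnorm (dual_fun c0_head2) = 1.
Proof.
apply/eqP; rewrite eq_le; apply/andP; split.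
  apply: opnorm_le => x x1; rewrite c0_head2E normrM ger0_norm//.
  exact: le_trans (c0_head_le x) x1.
have e1 : `|2^-1 *: e0| <= 1 by rewrite normrZ norm_c0_e0 ger0_norm// mulVf.
apply: le_trans (le_opnorm (dual_fun_bounded _) e1).
by rewrite c0_head2E c0Z c0_e0E /= mulr1 mulfV// normr1.
Qed.

Lemma c0_weak_star_index_le : weak_star_index X <= 3 / 4.
Proof.
(* With g(e_0) in (7/4, 2], both |2 - g(e_0)| and |g(z)| are at most 1/4, and since |x_0| <= 1/2 the
   distance to [c0_head2] is at most 1/8 + 1/4 = 3/8. *)
pose U : set (weak_star X) :=
  [set g : dual X | 7 / 4 < dual_fun g e0 :> R].
have e1 : `|2^-1 *: e0| <= 1 by rewrite normrZ norm_c0_e0 ger0_norm// mulVf.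
apply: (@weak_star_index_le _ _ _ c0_head2 U).
- by lra.
- exact: c0_head2_opnorm.
- apply: (open_comp (D := [set r : R | 7 / 4 < r])); last exact: open_gt.
  by move=> g _; exact: weak_star_continuous.
- exists c0_head2; split; first by rewrite /dual_unit_ball /= c0_head2_opnorm.
  by rewrite /U /= c0_head2E c0_e0E /=; lra.
- move=> g [g1 gU]; rewrite /dual_ball /=.
  have {}gU : 7 / 4 < dual_fun g e0 :> R by [].
  pose G x : R := dual_fun g x.
  have GD x y : G (x + y) = G x + G y.
    by have := dual_fun_linear g 1 x y; rewrite !scale1r.
  have GZ a x : G (a *: x) = a * G x by rewrite /G /dual_fun linearZ.
  have G1 x : `|x| <= 1 -> `|G x| <= 1 by exact: dual_unit_ball_le g1.
  apply: (@le_lt_trans _ _ (3 / 8)); last by lra.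
  apply: opnorm_le => x x1.
  rewrite /GRing.sub_fun /= c0_head2E -/(G x).
  have [z xE [z0 zn]] : exists2 z, x = x 0%N *: e0 + z &
      z 0%N = 0 /\ forall n, `|z n| <= 1.
    exists (x - x 0%N *: e0); first by rewrite addrC subrK.
    split=> [|[|n]]; rewrite c0B c0Z c0_e0E /= ?mulr1 ?subrr ?normr0//.
    by rewrite mulr0 subr0; exact: le_trans (c0_coord_le x _) x1.
  (* Head and supremum each contribute 1/2. Using both signs of [s] below yields |g(z)| <= 2 -
     g(e_0). *)
  have e0z s : `|s| = 1 :> R -> `|2^-1 *: e0 + (s / 2) *: z| <= 1.
    move=> s1; set w := _ + _.
    have w0 : `|w 0%N| = 2^-1.
      by rewrite c0D !c0Z z0 c0_e0E /= mulr0 addr0 mulr1 ger0_norm.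
    rewrite [leRHS](_ : 1 = `|w 0%N| + 2^-1); last by rewrite w0; lra.
    apply: c0_le_norm => -[|n]; first by rewrite w0.
    rewrite c0D !c0Z c0_e0E /= mulr0 add0r normrM normrM s1 mul1r ger0_norm//.
    by have := zn n.+1; lra.
  have Gz : `|G z| <= 1 / 4.
    have := G1 _ (e0z 1 (normr1 _)); have := G1 _ (e0z (- 1) (normrN1 _)).
    by move: gU; rewrite -/(G e0) !GD !GZ !ler_norml; lra.
  have Ge0 : `|2 - G e0| <= 1 / 4.
    by move: gU (G1 _ e1); rewrite -/(G e0) GZ !ler_norml; lra.
  have -> : 2 * x 0%N - G x = x 0%N * (2 - G e0) - G z.
    by rewrite [X in G X]xE GD GZ; ring.
  apply: le_trans (ler_normB _ _) _; rewrite normrM.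
  have x2 : `|x 0%N| <= 1 / 2 by have := c0_head_le x; lra.
  by have := ler_pM (normr_ge0 _) (normr_ge0 _) x2 Ge0; lra.
Qed.

(* If q = ||T + I|| < 1, then T (c0_step m) is within q of - c0_step m, so the
   coordinates of index >= 1 of a weak cluster point of T (c0_step m) are at
   most q - 1 < 0, and they cannot tend to 0. *)
Lemma c0_weakly_compact_opnorm_ge T : bounded_op X X T ->
  weakly_compact T -> 1 <= opnorm (T \+ @id X).
Proof.
move=> bT; rewrite /weakly_compact precompactE => cT.
rewrite leNgt; apply/negP; set q := opnorm _ => q1.
have Tstep m n : (0 < n <= m)%N -> T (c0_step m) n <= q - 1.
  move=> nm; suff : `|T (c0_step m) n + 1| <= q by rewrite ler_norml; lra.
  have -> : T (c0_step m) n + 1 = (T \+ @id X) (c0_step m) n.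
    by rewrite [RHS]c0D c0_stepE nm.
  apply: le_trans (c0_coord_le _ _) _; apply: le_opnorm (c0_step_le1 m).
  (* Boundedness of T + I, without which the supremum [opnorm] need not dominate the values. *)
  move=> r; have [M TM] := bT r; exists (M + r) => x xr.
  by apply: le_trans (ler_normD _ _) _; rewrite lerD// TM.
pose F : set_system (weak X) := (fun m => T (c0_step m) : weak X) @ \oo.
have [|y [_ yF]] := cT F _.
  exists 0%N => // m _; apply: subset_closure.
  by exists (c0_step m) => //; exact: c0_step_le1.
have yn n : (y : X) n.+1 <= q - 1.
  rewrite leNgt; apply/negP => yq.
  pose V : set (weak X) :=
    dual_fun (c0_dual n.+1) @^-1` [set r : R | q - 1 < r].
  have oV : open V.
    apply: open_comp; last exact: open_gt.
    by move=> x _; exact: weak_continuous.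
  (* The tail [n < m] consists of those [m] for which [c0_step m] has entry 1 at [n.+1]. *)
  have [|_ [[m nm <-]]] := yF [set T (c0_step m) | m in [set m | (n < m)%N]] V
    _ (open_nbhs_nbhs (conj oV yq)).
    by exists n.+1 => // m /= nm; exists m.
  by rewrite /V /= c0_dualE ltNge Tstep// nm.
have /cvgrPdist_lt/(_ (1 - q)) := c0_cvg (y : X).
rewrite subr_gt0 => /(_ q1)[N _ /(_ N.+1 (leqnSn _))] /=.
by have := yn N; rewrite sub0r normrN ltr_norml; lra.
Qed.

(** A rank-one, hence weakly compact, operator of norm 1. It shows that the infimum in the theorem
    is over a nonempty set; the infimum of the empty set would be 0 by default. *)
Definition c0_head_proj x : X := x 0%N *: e0.

Lemma c0_head_proj_linear : linear c0_head_proj.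
Proof. by move=> a x y; rewrite /c0_head_proj c0D c0Z scalerDl scalerA. Qed.

HB.instance Definition _ :=
  GRing.isLinear.Build R X X _ c0_head_proj c0_head_proj_linear.

Lemma norm_c0_head_proj x : `|c0_head_proj x| <= `|x|.
Proof. by rewrite normrZ norm_c0_e0 mulrC; exact: c0_head_le. Qed.

Lemma c0_head_proj_bounded : bounded_op X X c0_head_proj.
Proof.
apply: (@linear_bounded_fun_norm _ _ _ _ 1) => x.
by rewrite mul1r norm_c0_head_proj.
Qed.

Lemma c0_head_proj_opnorm : opnorm c0_head_proj = 1.
Proof.
apply/eqP; rewrite eq_le; apply/andP; split.
  by apply: opnorm_le => x; apply: le_trans; exact: norm_c0_head_proj.
have e1 : `|2^-1 *: e0| <= 1 by rewrite normrZ norm_c0_e0 ger0_norm// mulVf.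
apply: le_trans (le_opnorm c0_head_proj_bounded e1).
rewrite [leRHS](_ : _ = `|2^-1 *: e0|); last first.
  by rewrite /= /c0_head_proj [_ 0%N]c0Z c0_e0E mulr1.
by rewrite normrZ norm_c0_e0 ger0_norm// mulVf.
Qed.

Lemma c0_head_proj_weakly_compact : weakly_compact c0_head_proj.
Proof.
pose K : set (weak X) := (fun r : R => r *: e0) @` `[-1, 1].
apply: (@precompact_subset _ _ K).
  move=> _ [x x1 <-]; exists (x 0%N) => //=.
  rewrite in_itv /= -ler_norml; exact: le_trans (c0_coord_le x 0) x1.
have cK : compact K.
  apply: continuous_compact; last exact: segment_compact.
  exact/continuous_subspaceT/scale_weak_continuous.
suff clK : closed K by rewrite precompact_closed.
(* Weak closedness of the segment is read off the coordinate functionals: head in [-1, 1], all other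
   coordinates zero. *)
have -> : K = \bigcap_n (dual_fun (c0_dual n) @^-1`
    (if n == 0%N then [set r : R | r \in `[-1, 1]] else [set 0])).
  apply/seteqP; split=> [_ [r r1 <-] n _|x xK].
    rewrite /= c0_dualE c0Z c0_e0E.
    by case: eqP; rewrite ?mulr1 ?mulr0.
  have /= x0 := xK 0%N I; exists ((x : X) 0%N).
  - exact: x0.
  - apply: c0P => -[|n]; first by rewrite c0Z c0_e0E mulr1.
    by have xn := xK n.+1 I; rewrite c0Z c0_e0E mulr0; exact/esym.
apply: closed_bigI => n _; apply: preimage_closed.
  by move=> x _; exact: weak_continuous.
case: eqP => _; first exact: itv_closed.
exact: closed_eq.
Qed.

End c0_indices.

Theorem mainTheorem5 (R : realType) :
  exists X : completeNormedModType R,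
    (exists x : X, x != 0) /\
    inf [set opnorm (T \+ @id X) | T in
          [set T : {linear X -> X} |
            [/\ bounded_op X X T, opnorm T = 1 & weakly_compact T]]]
    <> Num.max (weak_index X) (weak_star_index X).
Proof.
exists (c0_space R); split.
  by exists (@c0_e0 R); rewrite -normr_gt0 norm_c0_e0.
(* The number 1 separates the two sides: the maximum is at most 3/4, the infimum at least 1. *)
apply/eqP; rewrite gt_eqF//; apply: (@lt_le_trans _ _ 1).
  by rewrite gt_max; apply/andP; split;
    [apply: le_lt_trans c0_weak_index_le _
    |apply: le_lt_trans c0_weak_star_index_le _]; lra.
apply: lb_le_inf.
  exists (opnorm ((c0_head_proj : {linear c0_space R -> c0_space R}) \+ @id _)).
  exists c0_head_proj => //; split.
  - exact: c0_head_proj_bounded.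
  - exact: c0_head_proj_opnorm.
  - exact: c0_head_proj_weakly_compact.
by move=> _ [T [bT _ cT] <-]; exact: c0_weakly_compact_opnorm_ge.
Qed.
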